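(* Let $A\subseteq\mathbb{N}$ and let $S_A:=\{(n,\top)\mid n\in A\}\cup\{(n,\bot)\mid n\notin A\}$, regarded as a subspace of $\mathbb{N}\times\mathbb{S}$. Then $S_A$ is precomputably Quasi-Polish if and only if $A$ is $\Delta^0_2$.
   Context: A represented space $\mathbf{X}=(X,\delta_{\mathbf{X}})$ is a set $X$ with a partial surjection $\delta_{\mathbf{X}}:\subseteq\mathbb{N}^{\mathbb{N}}\to X$; any $p$ with $\delta_{\mathbf X}(p)=x$ is a name of $x$. A subspace is a subset with the restricted representation (a point keeps all its names). A map $f:\mathbf{X}\to\mathbf{Y}$ is computable if some computable partial map on $\mathbb{N}^{\mathbb{N}}$ sends every name of every $x\in X$ to a name of $f(x)$. A computable isomorphism is a computable bijection with computable inverse. $\mathbb{N}$ is represented by $\delta_{\mathbb N}(p)=p(0)$. In the product $\mathbf{X}\times\mathbf{Y}$, $p$ names $(x,y)$ iff $n\mapsto p(2n)$ names $x$ and $n\mapsto p(2n+1)$ names $y$. Sierpinski space $\mathbb{S}=\{\top,\bot\}$ is represented so that $0^\omega$ names $\bot$ and every other sequence names $\top$. For a transitive relation $\ll$ on $\mathbb{N}$, an ideal is a non-empty $I\subseteq\mathbb{N}$ such that $x\ll y\in I$ implies $x\in I$, and for all $x,y\in I$ there is $z\in I$ with $x\ll z$ and $y\ll z$. $\mathbf{I}(\ll)$ is the represented space of ideals, where $p$ names $I$ iff $I=\{p(k)\mid k\in\mathbb{N}\}$. A represented space is precomputably Quasi-Polish if it is computably isomorphic to $\mathbf{I}(\ll)$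 for some computably enumerable transitive relation $\ll$ on $\mathbb N$. $\Delta^0_2$ refers to the (lightface) arithmetical hierarchy. *)

(* Defs.v *)
From mathcomp Require Import all_boot boolp classical_sets.
From Stdlib Require Cantor.

Set Implicit Arguments.
Unset Strict Implicit.
Unset Printing Implicit Defensive.

Local Open Scope classical_set_scope.

(** * Computability

   Oracle partial recursive functions, in the unary presentation: several
   arguments are packed into one by the Cantor pairing. *)

Definition baire := nat -> nat.

Definition pr (x y : nat) : nat := Cantor.to_nat (x, y).
Definition pr1 (z : nat) : nat := (Cantor.of_nat z).1.
Definition pr2 (z : nat) : nat := (Cantor.of_nat z).2.

Inductive code : Type :=
  | Zero | Succ | Fst | Snd | Oracle
  | Pair (f g : code)
  | Comp (f g : code)
  | Prec (f g : code)
  | Mu (f : code).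

Fixpoint prec_graph (F G : nat -> nat -> Prop) (a n : nat) : nat -> Prop :=
  match n with
  | 0 => F a
  | m.+1 => fun z => exists2 y, prec_graph F G a m y & G (pr a (pr m y)) z
  end.

(* [eval p c x z]: program [c] with oracle [p] halts on input [x] with output
   [z].  As usual, [Mu f] searches for the least zero, and diverges if [f]
   diverges before it is reached. *)
Fixpoint eval (p : baire) (c : code) : nat -> nat -> Prop :=
  match c with
  | Zero => fun _ z => z = 0
  | Succ => fun x z => z = x.+1
  | Fst => fun x z => z = pr1 x
  | Snd => fun x z => z = pr2 x
  | Oracle => fun x z => z = p x
  | Pair f g => fun x z =>
      exists a b, [/\ eval p f x a, eval p g x b & z = pr a b]
  | Comp f g => fun x z => exists2 y, eval p g x y & eval p f y z
  | Prec f g => fun x z => prec_graph (eval p f) (eval p g) (pr1 x) (pr2 x) z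
  | Mu f => fun x z =>
      eval p f (pr x z) 0 /\
      forall m, m < z -> exists k, eval p f (pr x m) k.+1
  end.

Lemma eval_functional p c x y z : eval p c x y -> eval p c x z -> y = z.
Proof.
elim: c x y z => /= [||||| f IHf g IHg | f IHf g IHg | f IHf g IHg | f IHf].
- by move=> x y z -> ->.
- by move=> x y z -> ->.
- by move=> x y z -> ->.
- by move=> x y z -> ->.
- by move=> x y z -> ->.
- move=> x y z [a [b [fa gb ->]]] [a' [b' [fa' gb' ->]]].
  by rewrite (IHf _ _ _ fa fa') (IHg _ _ _ gb gb').
- move=> x y z [a ga fy] [b gb fz].
  by rewrite (IHg _ _ _ ga gb) in fy; exact: IHf fy fz.
- move=> x; elim: (pr2 x) => [|n IHn] y z /=; first exact: IHf.
  move=> [a ha gy] [b hb gz].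
  by rewrite (IHn _ _ ha hb) in gy; exact: IHg gy gz.
- move=> x y z [fy ltfy] [fz ltfz]; case: (ltngtP y z) => // lt.
  + by have [k /(IHf _ _ _ fy)] := ltfz _ lt.
  + by have [k /(IHf _ _ _ fz)] := ltfy _ lt.
Qed.

(* Computability without an oracle is computability with the zero oracle: on
   it, the programs [Oracle] and [Zero] agree. *)
Definition eval0 : code -> nat -> nat -> Prop := eval (fun=> 0).

Definition computable_set (A : set nat) : Prop :=
  exists (c : code) (chi : nat -> bool),
    forall n, eval0 c n (chi n) /\ (A n <-> chi n).

Definition ce_relation (R : nat -> nat -> Prop) : Prop :=
  exists c : code, forall x y, R x y <-> exists z, eval0 c (pr x y) z.

Fixpoint Sigma0 (n : nat) (A : set nat) : Prop :=
  match n with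
  | 0 => computable_set A
  | m.+1 => exists2 B, Pi0 m B & forall x, A x <-> exists y, B (pr x y)
  end
with Pi0 (n : nat) (A : set nat) : Prop :=
  match n with
  | 0 => computable_set A
  | m.+1 => exists2 B, Sigma0 m B & forall x, A x <-> forall y, B (pr x y)
  end.

Definition Delta0 (n : nat) (A : set nat) : Prop := Sigma0 n A /\ Pi0 n A.

(** * Represented spaces *)

(* The partial surjection from Baire space is given by its graph [names]. *)
Record repspace : Type := RepSpace {
  points :> Type;
  names : baire -> points -> Prop;
  names_functional : forall p x y, names p x -> names p y -> x = y;
  names_surjective : forall x, exists p, names p x
}.
Arguments names : clear implicits.
Arguments RepSpace : clear implicits.

Definition computable_map (X Y : repspace) (f : X -> Y) : Prop :=
  exists c : code, forall p x, names X p x ->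
    exists2 q : baire, (forall n, eval p c n (q n)) & names Y q (f x).

Definition computably_isomorphic (X Y : repspace) : Prop :=
  exists (f : X -> Y) (g : Y -> X),
    [/\ cancel f g, cancel g f, computable_map f & computable_map g].

Section Subspace.
Variables (X : repspace) (P : set X).

Definition sub_names (p : baire) (x : {x : X | P x}) : Prop :=
  names X p (sval x).

Lemma sub_functional p x y : sub_names p x -> sub_names p y -> x = y.
Proof. case: x y => [x Px] [y Py] px py; apply: eq_exist; exact: names_functional px py. Qed.

Lemma sub_surjective x : exists p, sub_names p x.
Proof. exact: names_surjective. Qed.

Definition subspace : repspace :=
  RepSpace _ sub_names sub_functional sub_surjective.

End Subspace.

Section Product.
Variables X Y : repspace.

Definition prod_names (p : baire) (z : X * Y) : Prop :=
  names X (fun n => p (2 * n)) z.1 /\ names Y (fun n => p (2 * n + 1)) z.2.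

Lemma prod_functional p x y : prod_names p x -> prod_names p y -> x = y.
Proof.
case: x y => [x1 x2] [y1 y2] [/= h1 h2] [/= k1 k2].
by rewrite (names_functional h1 k1) (names_functional h2 k2).
Qed.

Lemma prod_surjective x : exists p, prod_names p x.
Proof.
have [q hq] := names_surjective x.1; have [r hr] := names_surjective x.2.
exists (fun n => if odd n then r n./2 else q n./2); split.
- suff -> : (fun n => if odd (2 * n) then r (2 * n)./2 else q (2 * n)./2) = q
    by [].
  by apply/funext => n; rewrite mul2n odd_double doubleK.
- suff -> : (fun n => if odd (2 * n + 1) then r (2 * n + 1)./2
                      else q (2 * n + 1)./2) = r by [].
  by apply/funext => n; rewrite mul2n addn1 /= odd_double /= uphalf_double.
Qed.

Definition product : repspace :=
  RepSpace _ prod_names prod_functional prod_surjective.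

End Product.

Definition nat_names (p : baire) (n : nat) : Prop := p 0 = n.

Lemma nat_functional p x y : nat_names p x -> nat_names p y -> x = y.
Proof. by move=> <- <-. Qed.

Lemma nat_surjective x : exists p, nat_names p x.
Proof. by exists (fun=> x). Qed.

Definition natural_numbers : repspace :=
  RepSpace _ nat_names nat_functional nat_surjective.

Inductive truth : Type := top | bot.

Definition sierpinski_names (p : baire) (t : truth) : Prop :=
  match t with
  | bot => p = (fun=> 0)
  | top => p <> (fun=> 0)
  end.

Lemma sierpinski_functional p x y :
  sierpinski_names p x -> sierpinski_names p y -> x = y.
Proof. by case: x y => [] []. Qed.

Lemma sierpinski_surjective x : exists p, sierpinski_names p x.
Proof.
case: x => /=; last by exists (fun=> 0).
by exists (fun=> 1) => /(congr1 (fun f : baire => f 0)).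
Qed.

Definition sierpinski : repspace :=
  RepSpace _ sierpinski_names sierpinski_functional sierpinski_surjective.

(** * Spaces of ideals *)

Definition transitive_relation (R : nat -> nat -> Prop) : Prop :=
  forall x y z, R x y -> R y z -> R x z.

Definition is_ideal (R : nat -> nat -> Prop) (I : set nat) : Prop :=
  [/\ I !=set0,
      forall x y, R x y -> I y -> I x &
      forall x y, I x -> I y -> exists z, [/\ I z, R x z & R y z]].

Section IdealSpace.
Variable R : nat -> nat -> Prop.

Definition ideal_names (p : baire) (I : {I : set nat | is_ideal R I}) : Prop :=
  sval I = range p.

Lemma ideal_functional p I J : ideal_names p I -> ideal_names p J -> I = J.
Proof. case: I J => [I iI] [J iJ] /= pI pJ; apply: eq_exist; exact: etrans pI (esym pJ). Qed.

Lemma ideal_surjective I : exists p, ideal_names p I.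
Proof.
case: I => I iI; have [[a Ia] _ _] := iI.
exists (fun n => if `[< I n >] then n else a); apply/seteqP; split => x /=.
- by move=> Ix; exists x => //; rewrite asboolT.
- by move=> [n _ <-]; case: asboolP.
Qed.

Definition ideal_space : repspace :=
  RepSpace _ ideal_names ideal_functional ideal_surjective.

End IdealSpace.

Definition precomputably_quasi_Polish (X : repspace) : Prop :=
  exists R : nat -> nat -> Prop,
    [/\ transitive_relation R, ce_relation R &
        computably_isomorphic X (ideal_space R)].

Definition S_space (A : set nat) : repspace :=
  @subspace (product natural_numbers sierpinski)
    ([set (n, top) | n in A] `|` [set (n, bot) | n in ~` A]).

(* Main.v *)
(* [S_A] meets each fibre [{n} x S] in a single point, so [n] is in [A] exactly
   when [(n, top)] is in [S_A], and not in [A] exactly when [(n, bot)] is.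

   If [F : S_A -> I(R)] and [G] are mutually inverse realizers and [p] is a
   computable name of [y] in [N x S], then [y] lies in [S_A] iff [F p]
   enumerates an ideal and [G (F p)] names [y].  This condition is Pi_2, uniformly in
   [n], for [y = (n, top)] as well as for [y = (n, bot)].

   Conversely, if [A n <-> forall k, P n k] and [~ A n <-> forall k, Q n k] with
   [P], [Q] semidecidable, take tokens [(n, (l, h))] of level [l] and height [h].
   Going up the order on tokens over [n], the level may change from zero to
   nonzero but not back, and as long as it does neither, the height increases;
   moreover a token [(n, (l, h))] is above another one only if [Q n k] (for
   [l = 0]) or [P n k] (for [l <> 0]) holds for all [k < h].  The only ideal over
   [n] then consists of all tokens over [n] if [n] is in [A], and of those of
   level [0] otherwise. *)
Require Import Defs.
From mathcomp Require Import all_boot boolp classical_sets.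
From Stdlib Require Cantor.

Set Implicit Arguments.
Unset Strict Implicit.
Unset Printing Implicit Defensive.

Arguments pr : simpl never.
Arguments pr1 : simpl never.
Arguments pr2 : simpl never.

Lemma pr1_pr x y : pr1 (pr x y) = x.
Proof. by rewrite /pr1 /pr Cantor.cancel_of_to. Qed.

Lemma pr2_pr x y : pr2 (pr x y) = y.
Proof. by rewrite /pr2 /pr Cantor.cancel_of_to. Qed.

Lemma pr_eta z : pr (pr1 z) (pr2 z) = z.
Proof. by rewrite /pr /pr1 /pr2 -surjective_pairing Cantor.cancel_to_of. Qed.

Definition prE := (pr1_pr, pr2_pr).

(** * Total computable functionals *)

(** Totality on every oracle and input keeps compositions free of domain conditions. Boolean-valued
    [F] are included through the coercion to [nat]. *)
Definition computable (F : baire -> nat -> nat) : Prop :=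
  exists c, forall p x, eval p c x (F p x).

Lemma computable_const k : computable (fun _ _ => k).
Proof.
elim: k => [|k [c hc]]; first by exists Zero.
by exists (Comp Succ c) => p x /=; exists k.
Qed.

Lemma computable_id : computable (fun _ x => x).
Proof.
exists (Pair Fst Snd) => p x /=; exists (pr1 x), (pr2 x).
by split=> //; rewrite pr_eta.
Qed.

Section Closure.
Variables F G : baire -> nat -> nat.
Hypotheses (cF : computable F) (cG : computable G).

Lemma computable_comp : computable (fun p x => F p (G p x)).
Proof.
have [[c hc] [d hd]] := (cF, cG).
by exists (Comp c d) => p x; exists (G p x).
Qed.

Lemma computable_succ : computable (fun p x => (F p x).+1).
Proof. by have [c hc] := cF; exists (Comp Succ c) => p x; exists (F p x). Qed.

Lemma computable_pr1 : computable (fun p x => pr1 (F p x)).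
Proof. by have [c hc] := cF; exists (Comp Fst c) => p x; exists (F p x). Qed.

Lemma computable_pr2 : computable (fun p x => pr2 (F p x)).
Proof. by have [c hc] := cF; exists (Comp Snd c) => p x; exists (F p x). Qed.

Lemma computable_oracle : computable (fun p x => p (F p x)).
Proof. by have [c hc] := cF; exists (Comp Oracle c) => p x; exists (F p x). Qed.

Lemma computable_pr : computable (fun p x => pr (F p x) (G p x)).
Proof.
have [[c hc] [d hd]] := (cF, cG).
by exists (Pair c d) => p x; exists (F p x), (G p x).
Qed.

End Closure.

(** [iteri] passes its counter to the step, so it is [Prec]; in the last hypothesis [z] packs
    parameter, counter and current value as [Prec] does. *)
Lemma computable_iteri (N F : baire -> nat -> nat)
    (G : baire -> nat -> nat -> nat -> nat) :
  computable N -> computable F ->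
  computable (fun p z => G p (pr1 z) (pr1 (pr2 z)) (pr2 (pr2 z))) ->
  computable (fun p x => iteri (N p x) (G p x) (F p x)).
Proof.
move=> cN [c hc] [d hd].
have [e he] := computable_pr computable_id cN.
exists (Comp (Prec c d) e) => p x; exists (pr x (N p x)) => //=.
rewrite !prE; elim: (N p x) => [|n IHn] /=; first exact: hc.
exists (iteri n (G p x) (F p x)) => //.
by have := hd p (pr x (pr n (iteri n (G p x) (F p x)))); rewrite !prE.
Qed.

Lemma computable_case (N F : baire -> nat -> nat)
    (G : baire -> nat -> nat -> nat) :
  computable N -> computable F ->
  computable (fun p z => G p (pr1 z) (pr2 z)) ->
  computable (fun p x => if N p x is m.+1 then G p x m else F p x).
Proof.
move=> cN cF cG.
(* Iterating a step that ignores the current value leaves only its last application, whose counter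
   is the predecessor. *)
rewrite (_ : (fun p x => _) =
    fun p x => iteri (N p x) (fun m _ => G p x m) (F p x)); last first.
  by apply/funext => p; apply/funext => x; case: (N p x).
apply: (computable_iteri (G := fun p x m _ => G p x m)) => //.
have cz : computable (fun p z => pr (pr1 z) (pr1 (pr2 z))).
  by do ?[exact: computable_id | apply: computable_pr | apply: computable_pr1
         | apply: computable_pr2].
have := computable_comp cG cz.
by congr computable; apply/funext => p; apply/funext => z; rewrite !prE.
Qed.

Lemma computable_if (b : baire -> nat -> bool)
    (F G : baire -> nat -> nat) :
  computable b -> computable F -> computable G ->
  computable (fun p x => if b p x then F p x else G p x).
Proof.
move=> cb cF cG.
have cF' : computable (fun p z => F p (pr1 z)).
  exact: computable_comp cF (computable_pr1 computable_id).
have := computable_case (G := fun p x _ => F p x) cb cG cF'.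
by congr computable; apply/funext => p; apply/funext => x; case: (b p x).
Qed.

Ltac computable := repeat first
  [ assumption | exact: computable_const | exact: computable_id
  | apply: computable_succ | apply: computable_pr1 | apply: computable_pr2
  | apply: computable_oracle | apply: computable_pr
  | apply: computable_iteri | apply: computable_if | apply: computable_case
  | match goal with |- computable (fun p x => ?F p (@?G p x)) =>
      is_var F; apply: (@computable_comp F G) end
  | match goal with |- computable (fun p x => ?f (@?G p x)) =>
      is_var f; apply: (@computable_comp (fun _ => f) G) end ].

Lemma computable_leq (F G : baire -> nat -> nat) :
  computable F -> computable G -> computable (fun p x => F p x <= G p x).
Proof.
move=> cF cG.
(* Iterated predecessor is truncated subtraction, which vanishes exactly when [F p x <= G p x]. *)
have cS : computable
    (fun p x => iteri (G p x) (fun _ y => if y is m.+1 then m else 0) (F p x)).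
  by computable.
have cB : computable (fun p x =>
   if iteri (G p x) (fun _ y => if y is m.+1 then m else 0) (F p x) is _.+1
   then 0 else 1) by computable.
move: cB; congr computable; apply/funext => p; apply/funext => x.
suff -> : iteri (G p x) (fun _ y => if y is m.+1 then m else 0) (F p x)
          = F p x - G p x by rewrite -subn_eq0; case: (_ - _).
by elim: (G p x) => [|n] /=; [rewrite subn0 | rewrite subnS => ->; case: (_ - _)].
Qed.

Section Booleans.
Variables b c : baire -> nat -> bool.
Hypotheses (cb : computable b) (cc : computable c).

Lemma computable_negb : computable (fun p x => ~~ b p x).
Proof.
have : computable (fun p x => if b p x then 0 else 1) by computable.
by congr computable; apply/funext => p; apply/funext => x; case: (b p x).
Qed.

Lemma computable_andb : computable (fun p x => b p x && c p x).
Proof.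
have : computable (fun p x => if b p x then c p x : nat else 0) by computable.
by congr computable; apply/funext => p; apply/funext => x; case: (b p x).
Qed.

Lemma computable_orb : computable (fun p x => b p x || c p x).
Proof.
have : computable (fun p x => if b p x then 1 else c p x : nat) by computable.
by congr computable; apply/funext => p; apply/funext => x; case: (b p x).
Qed.

End Booleans.

Lemma computable_eqn (F G : baire -> nat -> nat) :
  computable F -> computable G -> computable (fun p x => F p x == G p x).
Proof.
move=> cF cG.
have := computable_andb (computable_leq cF cG) (computable_leq cG cF).
by congr computable; apply/funext => p; apply/funext => x; rewrite eqn_leq.
Qed.

(** * Kleene normal form *)

(* [run p c s x] is [z.+1] if [c] outputs [z] within the search bound [s], and
   [0] otherwise; only the search depth of [Mu] is bounded. *)
Fixpoint run (p : baire) (c : code) (s x : nat) : nat :=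
  match c with
  | Zero => 1
  | Succ => x.+2
  | Fst => (pr1 x).+1
  | Snd => (pr2 x).+1
  | Oracle => (p x).+1
  | Pair f g =>
      if run p f s x is a.+1
      then if run p g s x is b.+1 then (pr a b).+1 else 0 else 0
  | Comp f g => if run p g s x is y.+1 then run p f s y else 0
  | Prec f g =>
      iteri (pr2 x)
        (fun m r =>
           if r is y.+1 then run p g s (pr (pr1 x) (pr m y)) else 0)
        (run p f s (pr1 x))
  | Mu f =>
      let u := iteri s
        (fun _ u => if run p f s (pr x u) is r.+1
                    then if r is _.+1 then u.+1 else u else u) 0 in
      if run p f s (pr x u) is r.+1 then if r is _.+1 then 0 else u.+1 else 0
  end.

Lemma run_sound p c s x z : run p c s x = z.+1 -> eval p c x z.
Proof.
elim: c x z => /= [||||| f IHf g IHg | f IHf g IHg | f IHf g IHg | f IHf] x z.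
- by case.
- by case.
- by case.
- by case.
- by case.
- case ef: (run p f s x) => [|a] //; case eg: (run p g s x) => [|b] // [<-].
  by exists a, b; split; [exact: IHf | exact: IHg |].
- case eg: (run p g s x) => [|y] // ef.
  by exists y; [exact: IHg | exact: IHf].
- elim: (pr2 x) z => [|n IHn] z /=; first exact: IHf.
  case e: (iteri n _ _) => [|y] // eg.
  by exists y; [exact: IHn | exact: IHg].
- set step := (fun _ _ => _); set u := iteri s step 0 => h.
  have uz : u = z by move: h; case: (run _ _ _ _) => [|[|?]] // [].
  have h0 : run p f s (pr x z) = 1.
    by move: h; rewrite uz; case: (run _ _ _ _) => [|[|?]].
  split; first exact: IHf.
  (* The counter only moves past arguments at which a positive value of [f] has been found, so
     everything below it has been checked. *)
  suff lt n m : m < iteri n step 0 -> exists k, run p f s (pr x m) = k.+2.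
    by move=> m; rewrite -uz => /lt[k hk]; exists k; exact: IHf.
  elim: n => [|n IHn] //=.
  set v := iteri n step 0 in IHn *.
  rewrite {1}/step; case e: (run p f s (pr x v)) => [|[|k]] //=.
  by rewrite ltnS leq_eqVlt => /orP[/eqP->|]; [exists k | exact: IHn].
Qed.

(** Claiming success for all large [s], not just for one, lets the bounds of subprograms be merged
    by [maxn]. *)
Lemma run_complete p c x z :
  eval p c x z -> exists s0, forall s, s0 <= s -> run p c s x = z.+1.
Proof.
elim: c x z => /= [||||| f IHf g IHg | f IHf g IHg | f IHf g IHg | f IHf] x z.
- by move=> ->; exists 0.
- by move=> ->; exists 0.
- by move=> ->; exists 0.
- by move=> ->; exists 0.
- by move=> ->; exists 0.
- move=> [a [b [/IHf[s hs] /IHg[t ht] ->]]]; exists (maxn s t) => i.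
  by rewrite geq_max => /andP[/hs-> /ht->].
- move=> [y /IHg[t ht] /IHf[s hs]]; exists (maxn s t) => i.
  by rewrite geq_max => /andP[/hs ? /ht->].
- elim: (pr2 x) z => [|n IHn] z /=; first exact: IHf.
  move=> [y /IHn[t ht] /IHg[s hs]]; exists (maxn s t) => i.
  by rewrite geq_max => /andP[/hs ? /ht->].
- move=> [/IHf[s hs] lt].
  have [t ht] : exists t, forall i, t <= i -> forall m, m < z ->
      exists k, run p f i (pr x m) = k.+2.
    elim: z lt {hs} => [|z IHz] lt; first by exists 0.
    have [m mz|t ht] := IHz _; first by apply: lt; exact: ltnW.
    have [k /IHf[r hr]] := lt z (ltnSn z).
    exists (maxn t r) => i; rewrite geq_max => /andP[/ht hi /hr ri] m.
    by rewrite ltnS leq_eqVlt => /orP[/eqP->|/hi //]; exists k.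
  exists (maxn z (maxn s t)) => i.
  rewrite !geq_max => /and3P[zi /hs ri /ht hi].
  set step := (fun _ _ => _).
  suff -> : iteri i step 0 = z by rewrite ri.
  (* The counter advances by one per round until it reaches the least zero [z] and then stays;
     [z <= i] leaves enough rounds. *)
  suff -> n : iteri n step 0 = minn n z by apply/minn_idPr.
  elim: n => [|n IHn] /=; first by rewrite min0n.
  rewrite IHn /step; case: (ltnP n z) => nz.
    by have [k ->] := hi _ nz; rewrite (minn_idPl nz).
  by rewrite ri (minn_idPr (leqW nz)).
Qed.

Lemma evalE p c x z : eval p c x z <-> exists s, run p c s x = z.+1.
Proof.
split=> [/run_complete[s hs]|[s /run_sound //]].
by exists s; exact: hs.
Qed.

(** For fixed [c], [run] unfolds into finitely many total operations. [N], [S] and [X] vary in the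
    induction because recursion and search call subprograms on new inputs; [P] lets the oracle
    depend on the input. *)
Lemma computable_run (P : nat -> baire) c (N S X : baire -> nat -> nat) :
  computable (fun _ z => P (pr1 z) (pr2 z)) ->
  computable N -> computable S -> computable X ->
  computable (fun p z => run (P (N p z)) c (S p z) (X p z)).
Proof.
move=> cP.
elim: c N S X => /= [||||| f IHf g IHg | f IHf g IHg | f IHf g IHg | f IHf]
  N S X cN cS cX.
1-4: by computable.
- apply: computable_succ.
  have := computable_comp cP (computable_pr cN cX).
  by congr computable; apply/funext => p; apply/funext => z; rewrite !prE.
- by do ?[progress computable | apply IHf | apply IHg].
- by do ?[progress computable | apply IHf | apply IHg].
- by do ?[progress computable | apply IHf | apply IHg].
- by do ?[progress computable | apply IHf].
Qed.


(** * Composing programs by oracle substitution *)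

Fixpoint subst (d c : code) : code :=
  match c with
  | Oracle => d
  | Pair f g => Pair (subst d f) (subst d g)
  | Comp f g => Comp (subst d f) (subst d g)
  | Prec f g => Prec (subst d f) (subst d g)
  | Mu f => Mu (subst d f)
  | c => c
  end.

(** Only [Oracle] matters: at [k] the program [d] yields [q k] and, by functionality, nothing
    else. *)
Lemma eval_subst p q c d :
  (forall k, eval p d k (q k)) -> eval p (subst d c) = eval q c.
Proof.
move=> dq; elim: c => //= [|f -> g ->|f -> g ->|f -> g ->|f ->] //.
apply/funext => x; apply/funext => z; apply/propext.
by split=> [h|->//]; exact: eval_functional h (dq x).
Qed.

Lemma computable_setP (A : set nat) : computable_set A <->
  exists2 b : nat -> bool, computable (fun _ x => b x) & forall x, A x <-> b x.
Proof.
split=> [[c [b hb]]|[b [c hc] Ab]]; last first.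
  by exists c, b => x; split=> //; exact: hc.
exists b => [|x]; last by case: (hb x).
(* Answering every query by 0 makes the program independent of the actual oracle. *)
exists (subst Zero c) => p x; rewrite (@eval_subst p (fun=> 0)) //.
by case: (hb x).
Qed.

(** * Semidecidable sets *)

Definition ce_set (S : nat -> Prop) : Prop :=
  exists c, forall x, S x <-> exists z, eval0 c x z.

Lemma ce_setP (S : nat -> Prop) : ce_set S <->
  exists2 b : nat -> bool, computable (fun _ x => b x) &
    forall x, S x <-> exists y, b (pr x y).
Proof.
split=> [[c hc]|[b cb hb]].
  (* The witness is a search bound at which the program has produced an output. *)
  exists (fun z => 0 < run (fun=> 0) c (pr2 z) (pr1 z)) => [|x].
    apply: computable_leq; first exact: computable_const.
    by apply: (@computable_run (fun _ _ => 0) c (fun _ _ => 0)); computable.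
  rewrite hc; split=> [[z /evalE[s e]]|[s]]; first by exists s; rewrite !prE e.
  rewrite !prE; case e: (run _ _ _ _) => [|z] // _.
  by exists z; apply/evalE; exists s.
have [c hc] := computable_negb cb.
(* [Mu] seeks a zero, hence the negated test. *)
exists (Mu c) => x; rewrite hb; split=> [|[z [h _]]]; last first.
  exists z; have := hc (fun=> 0) (pr x z).
  by move/(eval_functional h); case: (b _).
move=> /ex_minnP[z bz minz]; exists z; split=> [|m mz].
  by have := hc (fun=> 0) (pr x z); rewrite bz.
exists 0; have := hc (fun=> 0) (pr x m); case e: (b _) => //.
by move: mz; rewrite ltnNge minz.
Qed.

(** * Low levels and complements in the arithmetical hierarchy *)

Lemma Sigma0_1E (S : set nat) : Sigma0 1 S <-> ce_set S.
Proof.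
rewrite ce_setP; split=> [[B /computable_setP[b cb Bb] SB]|[b cb Sb]].
  by exists b => // x; rewrite SB; split=> -[y] /Bb; exists y.
by exists (fun x => b x) => //; apply/computable_setP; exists b.
Qed.

Lemma Pi0_2E (A : set nat) : Pi0 2 A <->
  exists2 T : nat -> nat -> Prop,
    ce_set (fun z => T (pr1 z) (pr2 z)) & forall x, A x <-> forall y, T x y.
Proof.
split=> [[B /Sigma0_1E cB AB]|[T cT AT]].
  exists (fun x y => B (pr x y)) => //.
  by under eq_fun do rewrite pr_eta.
exists (fun z => T (pr1 z) (pr2 z)); first exact/Sigma0_1E.
by move=> x; rewrite AT; split=> h y; have := h y; rewrite !prE.
Qed.

(** Each implication at one level rests on the other at the level below, so a single induction
    proves both. *)
Lemma arithmetical_setC n (A : set nat) :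
  (Sigma0 n A -> Pi0 n (~` A)%classic) /\ (Pi0 n A -> Sigma0 n (~` A)%classic).
Proof.
elim: n A => [|n IHn] A.
  suff cA : computable_set A -> computable_set (~` A)%classic by [].
  move=> /computable_setP[b cb Ab]; apply/computable_setP.
  exists (fun x => ~~ b x); first exact: computable_negb.
  by move=> x; split=> [nA|/negP nb /Ab //]; apply/negP => /Ab.
split=> -[B hB AB]; exists (~` B)%classic; try by [have [] := IHn B; auto].
  move=> x; split=> [nA y By|nB /AB[y By]]; last exact: nB By.
  by apply: nA; apply/AB; exists y.
move=> x; split=> [nA|[y nB] /AB By]; last exact: nB (By y).
by apply: contrapT => nB; apply: nA; apply/AB => y; apply: contrapT => By;
  apply: nB; exists y.
Qed.

(** * Closure properties of semidecidable sets *)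

Lemma ce_dec (b : nat -> bool) :
  computable (fun _ x => b x) -> ce_set (fun x => b x).
Proof.
move=> cb; apply/ce_setP; exists (fun z => b (pr1 z)).
  exact: computable_comp cb (computable_pr1 computable_id).
by move=> x; split=> [bx|[y]]; [exists 0 |]; rewrite prE.
Qed.

Lemma ce_comp (S : nat -> Prop) (h : nat -> nat) :
  ce_set S -> computable (fun _ => h) -> ce_set (fun x => S (h x)).
Proof.
move=> [c hc] [d hd]; exists (Comp c d) => x; rewrite hc.
split=> -[z]; first by exists z, (h x) => //; exact: hd.
by move=> [y /(eval_functional (hd _ _)) <-]; exists z.
Qed.

Lemma ce_and (S T : nat -> Prop) :
  ce_set S -> ce_set T -> ce_set (fun x => S x /\ T x).
Proof.
move=> [c hc] [d hd]; exists (Pair c d) => x; rewrite hc hd.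
split=> [[[a ha] [b hb]]|[z [a [b [ha hb _]]]]].
  by exists (pr a b), a, b.
by split; [exists a | exists b].
Qed.

(** Running one program after the other could diverge too early; in normal form a single witness is
    tested for both sets at once. *)
Lemma ce_or (S T : nat -> Prop) :
  ce_set S -> ce_set T -> ce_set (fun x => S x \/ T x).
Proof.
move=> /ce_setP[b cb hb] /ce_setP[c cc hc]; apply/ce_setP.
exists (fun z => b z || c z); first exact: computable_orb.
move=> x; rewrite hb hc; split=> [[[y h]|[y h]]|[y /orP[h|h]]].
- by exists y; rewrite h.
- by exists y; rewrite h orbT.
- by left; exists y.
- by right; exists y.
Qed.

Lemma ce_ex (S : nat -> nat -> Prop) :
  ce_set (fun z => S (pr1 z) (pr2 z)) -> ce_set (fun x => exists y, S x y).
Proof.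
move=> /ce_setP[b cb hb]; apply/ce_setP.
exists (fun z => b (pr (pr (pr1 z) (pr1 (pr2 z))) (pr2 (pr2 z)))).
  by apply: (computable_comp cb); computable.
move=> x; split=> [[y]|[v]].
  have := hb (pr x y); rewrite !prE => -> [w h].
  by exists (pr y w); rewrite !prE.
rewrite !prE => h; exists (pr1 v); have := hb (pr x (pr1 v)).
by rewrite !prE => ->; exists (pr2 v).
Qed.

(** [Prec Zero c] runs the semidecision of [S x k] for each [k < N x] in turn and halts iff all of
    them do; the values passed along carry no information. *)
Lemma ce_ball (N : nat -> nat) (S : nat -> nat -> Prop) :
  computable (fun _ => N) -> ce_set (fun z => S (pr1 z) (pr2 z)) ->
  ce_set (fun x => forall k, k < N x -> S x k).
Proof.
move=> cN cS.
have [c hc] : ce_set (fun z => S (pr1 z) (pr1 (pr2 z))).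
  have := @ce_comp _ (fun z => pr (pr1 z) (pr1 (pr2 z))) cS.
  by under [X in ce_set X]eq_fun do rewrite !prE; apply; computable.
have [d hd] := computable_pr computable_id cN.
exists (Comp (Prec Zero c) d) => x.
suff {d hd} E : (exists z, prec_graph (eval0 Zero) (eval0 c) x (N x) z) <->
    forall k, k < N x -> S x k.
  rewrite -E; split=> [[z h]|[z [y /(eval_functional (hd _ _)) <-]]].
    by exists z, (pr x (N x)); [exact: hd | rewrite /= !prE].
  by rewrite /= !prE; exists z.
elim: (N x) => [|n IHn] /=; first by split=> // _; exists 0.
split=> [[z [y h g]] k|Sn].
  rewrite ltnS leq_eqVlt => /orP[/eqP->|]; last by move: k; apply/IHn; exists y.
  by have [_] := hc (pr x (pr n y)); rewrite !prE; apply; exists z.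
have [_ /(_ (fun k kn => Sn k (leqW kn)))[y h]] := IHn.
have [+ _] := hc (pr x (pr n y)); rewrite !prE => -[|z g]; first exact: Sn.
by exists z, y.
Qed.

Lemma ce_eval (P : nat -> baire) c (N X Z : nat -> nat) :
  computable (fun _ z => P (pr1 z) (pr2 z)) ->
  computable (fun _ => N) -> computable (fun _ => X) ->
  computable (fun _ => Z) ->
  ce_set (fun z => eval (P (N z)) c (X z) (Z z)).
Proof.
move=> cP cN cX cZ.
rewrite (_ : (fun z => _) =
    fun z => exists s, run (P (N z)) c s (X z) == (Z z).+1); last first.
  apply/funext => z; apply/propext; rewrite evalE.
  by split=> -[s /eqP]; exists s.
apply: (@ce_ex (fun z s => run (P (N z)) c s (X z) == (Z z).+1)).
apply: ce_dec; apply: computable_eqn; last by computable.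
by apply: computable_run => //; computable.
Qed.

Lemma ce_rel (R : nat -> nat -> Prop) (X Y : nat -> nat) :
  ce_relation R -> computable (fun _ => X) -> computable (fun _ => Y) ->
  ce_set (fun z => R (X z) (Y z)).
Proof.
move=> [c hc] cX cY.
have : ce_set (fun z => R (pr1 z) (pr2 z)).
  by exists c => z; rewrite hc pr_eta.
move/(@ce_comp _ (fun z => pr (X z) (Y z))).
by under [X in ce_set X]eq_fun do rewrite !prE; apply; computable.
Qed.

(** Odd positions of a product name hold its second component; [2 * n + 1] arises by adding two to
    1, [n] times. *)
Lemma computable_odd (F : baire -> nat -> nat) :
  computable F -> computable (fun p x => 2 * F p x + 1).
Proof.
move=> cF.
have : computable (fun p x => iteri (F p x) (fun _ y => y.+2) 1) by computable.
congr computable; apply/funext => p; apply/funext => x.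
by elim: (F p x) => //= n ->; rewrite mulnS.
Qed.

(** * Points of [S_space A] and their names *)

Section Points.
Variable A : set nat.

Lemma S_space_top (x : S_space A) : (sval x).2 = top <-> A (sval x).1.
Proof. by case: x => z zA /=; case: zA => -[n An <-]; split. Qed.

(** Membership in [A] of the first coordinate decides whether the second is [top]. *)
Lemma S_space_eq (x y : S_space A) : (sval x).1 = (sval y).1 -> x = y.
Proof.
move=> xy; suff : sval x = sval y.
  by case: x y {xy} => x xA [y yA] /= xy; exact: eq_exist.
have := S_space_top x; have := S_space_top y; rewrite -xy.
by case: (sval x) (sval y) xy => [n []] [m []] /= <- // [h k] [h' k'];
  [have := k (h' erefl) | have := k' (h erefl)].
Qed.

Lemma S_space_point n : exists x : S_space A, (sval x).1 = n.
Proof.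
have [An|An] := pselect (A n).
  by exists (exist _ (n, top) (or_introl (ex_intro2 _ _ n An erefl))).
by exists (exist _ (n, bot) (or_intror (ex_intro2 _ _ n An erefl))).
Qed.

(** Trades the Sierpinski component for membership in [A], the form in which both directions handle
    names. *)
Lemma S_space_names (p : baire) (x : S_space A) :
  names (S_space A) p x <->
  p 0 = (sval x).1 /\ (A (sval x).1 <-> exists k, p (2 * k + 1) != 0).
Proof.
rewrite -S_space_top; change (names _ p x) with (sub_names p x).
rewrite /sub_names; case: (sval x) => n t; rewrite /= /prod_names /nat_names /=.
split=> -[p0 h]; split=> //; case: t h => /= h.
- split=> // _; apply: contrapT => np; apply: h; apply/funext => k.
  by apply/eqP; apply: contrapT => /negP pk; apply: np; exists k.
- split=> // -[k].
  by have -> : p (2 * k + 1) = 0 := congr1 (fun q : baire => q k) h.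
- have [k pk] := h.1 erefl => p0'.
  by move/eqP: pk; apply; exact: (congr1 (fun q : baire => q k) p0').
- apply/funext => k; apply/eqP; apply: contrapT => /negP pk.
  by have := h.2 (ex_intro _ k pk).
Qed.

End Points.

(* A name of [(n, top)] if [b], and of [(n, bot)] otherwise. *)
Definition point_name (b : bool) (n : nat) : baire :=
  fun k => if k is _.+1 then b else n.

Lemma computable_point_name b :
  computable (fun _ z => point_name b (pr1 z) (pr2 z)).
Proof. by rewrite /point_name; computable. Qed.

(** * From an ideal presentation to Pi_2 definitions *)

Ltac ce := repeat first
  [ apply: ce_and | apply: ce_ex | apply: ce_rel
  | apply: ce_eval; first exact: computable_point_name
  | progress computable ].

(** [A n <-> b] says that the point named by [point_name b n] lies in [S_space A], so one argument
    treats [A] and its complement alike. *)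
Lemma Pi0_2_of_quasi_Polish (A : set nat) (b : bool) :
  precomputably_quasi_Polish (S_space A) -> Pi0 2 (fun n => A n <-> b).
Proof.
(* [h] runs the realizer [d] of [g] on the output of the realizer [c] of [f]. *)
move=> [R [_ ceR [f [g [fK _ [c hc] [d hd]]]]]].
pose p n := point_name b n; pose h := subst c d.
have [r hr] := ceR.
(* Downward closure has a semidecidable premise; moving its stage [s] to the outer universal
   quantifier makes the premise decidable and the implication semidecidable. *)
pose lower n u v k s :=
  (run (fun=> 0) r s (pr u v) == 0) || (run (p n) c s k != v.+1) \/
  exists i, eval (p n) c i u.
(* This also forces [c] to halt at [u] and [v]. *)
pose directed n u v := exists x y k z,
  (eval (p n) c u x /\ eval (p n) c v y) /\
  (eval (p n) c k z /\ (R x z /\ R y z)).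
(* For [top] one nonzero odd entry suffices; for [bot] all are zero, with [k] quantified outside. *)
pose value n k := if b then exists i z, eval (p n) h (2 * i + 1) z.+1
  else eval (p n) h (2 * k + 1) 0.
apply/Pi0_2E; exists (fun n y =>
  (* The single variable [y] packs all universal variables; its first component serves every
     conjunct that needs one. *)
  (lower n (pr1 y) (pr1 (pr2 y)) (pr1 (pr2 (pr2 y))) (pr2 (pr2 (pr2 y))) /\
   directed n (pr1 y) (pr1 (pr2 y))) /\
  (eval (p n) h 0 n /\ value n (pr1 y))).
  apply: ce_and; [apply: ce_and | apply: ce_and].
  - apply: ce_or; last by ce.
    apply: ce_dec; apply: computable_orb.
      apply: computable_eqn; last by computable.
      by apply: (@computable_run (fun _ _ => 0) r (fun _ _ => 0)); computable.
    apply: computable_negb; apply: computable_eqn; last by computable.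
    by apply: computable_run; computable; exact: computable_point_name.
  - by ce.
  - by ce.
  - rewrite /value; case: (b); ce; apply: computable_odd; computable.
move=> n; split=> [Ab y|h_].
  have [x xn] := S_space_point A n.
  have px : names (S_space A) (p n) x.
    apply/S_space_names; rewrite xn; split=> //; rewrite Ab.
    split=> [bT|[k]]; first by exists 0; rewrite /p /= bT.
    by rewrite /p /point_name addn1; case: (b).
  have [q hq qf] := hc _ _ px; have [e he eg] := hd _ _ qf.
  have hE k : eval (p n) h k (e k) by rewrite /h (eval_subst _ hq).
  move: eg; rewrite fK => /S_space_names; rewrite xn Ab => -[e0 eb].
  have [_ low dir] := svalP (f x); rewrite qf in low dir.
  split; split.
  - rewrite /lower; 
    move: (pr1 y) (pr1 (pr2 y)) (pr1 (pr2 (pr2 y))) (pr2 (pr2 (pr2 y))).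
    move=> u v k s.
    case e1: (run _ r _ _) => [|w]; first by left.
    case e2: (run _ c _ _ == _); last by left; rewrite orbT.
    right; have qk := eval_functional (hq k) (run_sound (eqP e2)).
    have Ruv : R u v by apply/hr; exists w; exact: run_sound e1.
    have [|i _ qi] := low _ _ Ruv; first by exists k.
    by exists i; rewrite -qi.
  - move: (pr1 y) (pr1 (pr2 y)) => u v.
    have [||z [[k _ <-] Ru Rv]] := dir (q u) (q v); [by exists u | by exists v |].
    by exists (q u), (q v), k, (q k).
  - by have := hE 0; rewrite e0.
  - rewrite /value; move: eb; case: (b) => eb.
      have [i ei] := eb.1 erefl; exists i, (e (2 * i + 1)).-1.
      by rewrite prednK ?lt0n.
    have := hE (2 * pr1 y + 1); case ek: (e _) => [|k] //.
    suff /eb : exists i, e (2 * i + 1) != 0 by [].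
    by exists (pr1 y); rewrite ek.
have low u v k s : lower n u v k s.
  by have [[]] := h_ (pr u (pr v (pr k s))); rewrite !prE.
have dir u v : directed n u v.
  by have [[]] := h_ (pr u (pr v 0)); rewrite !prE.
have h0 : eval (p n) h 0 n by have [_ []] := h_ 0.
have val k : value n k by have [_ [_]] := h_ (pr k 0); rewrite !prE.
(* Totality of [c] on [p n], read off from [directed] on the diagonal, gives the enumerated
   sequence. *)
have /choice[q hq] : forall u, exists x, eval (p n) c u x.
  by move=> u; have [x [y [k [z [[]]]]]] := dir u u; exists x.
have qI : is_ideal R (range q).
  split; first by exists (q 0), 0.
    move=> u v /hr[w /run_complete[s1 e1]] [k _ qk].
    have := hq k; rewrite qk => /run_complete[s2 e2].
    (* At this stage both computations have halted, so only the conclusion of [lower] remains. *)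
    have := low u v k (maxn s1 s2).
    rewrite /lower e1 ?leq_maxl // e2 ?leq_maxr // eqxx => -[//|[i]].
    by move=> /(eval_functional (hq i)); exists i.
  move=> _ _ [u _ <-] [v _ <-].
  have [x [y [k [z [[]]]]]] := dir u v.
  move=> /(eval_functional (hq u)) <- /(eval_functional (hq v)) <-.
  move=> [/(eval_functional (hq k)) <- [Ru Rv]].
  by exists (q k); split=> //; exists k.
(* Since [q] names an ideal, [e] names some point of [S_space A]; [h0] and [val] then identify its
   coordinates. *)
have [e he] := hd q (exist _ _ qI) erefl.
have hE k z : eval (p n) h k z -> e k = z.
  by rewrite /h (eval_subst _ hq); exact: eval_functional.
move=> /S_space_names[]; rewrite (hE _ _ h0) => <- ->.
move: val; rewrite /value; case: (b) => val.
  split=> // _; have [i [z /hE ei]] := val 0; exists i.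
  by rewrite ei.
by split=> // -[k]; rewrite (hE _ _ (val k)).
Qed.

(** * The token relation *)

Definition level (z : nat) : nat := pr1 (pr2 z).
Definition height (z : nat) : nat := pr2 (pr2 z).

Section Tokens.
Variables (A : set nat) (P Q : nat -> nat -> Prop).
Hypotheses (ceP : ce_set (fun z => P (pr1 z) (pr2 z)))
  (ceQ : ce_set (fun z => Q (pr1 z) (pr2 z))).
Hypotheses (AP : forall n, A n <-> forall k, P n k)
  (AQ : forall n, ~ A n <-> forall k, Q n k).

(** Strict lexicographic order on the truth value of nonzero level, then height. *)
Definition below (x y : nat) : bool :=
  if level x == 0 then (level y != 0) || (height x < height y)
  else (level y != 0) && (height x < height y).

Definition evidence (l n k : nat) : Prop :=
  l == 0 /\ Q n k \/ l != 0 /\ P n k.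

Definition token_lt (x y : nat) : Prop :=
  (pr1 x == pr1 y) && below x y /\
  forall k, k < height y -> evidence (level y) (pr1 y) k.

Lemma below_trans y x z : below x y -> below y z -> below x z.
Proof.
rewrite /below; case: (level x == 0); case: (level y == 0) => //=;
  case: (level z == 0) => //=; exact: ltn_trans.
Qed.

(** The evidence concerns the upper token alone, so that of the second comparison serves the
    composite. *)
Lemma token_lt_trans : transitive_relation token_lt.
Proof.
move=> x y z [/andP[/eqP xy bxy] _] [/andP[/eqP yz byz] h].
by split=> //; rewrite xy yz eqxx (below_trans bxy byz).
Qed.

Lemma evidenceP l n : (forall k, evidence l n k) <-> (A n <-> l != 0).
Proof.
rewrite /evidence; case: (l == 0) => /=.
  rewrite (_ : (A n <-> false) = ~ A n) ?AQ; last first.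
    by apply/propext; split=> [[h _] /h|nA] //; split.
  by split=> h k; [case: (h k) => -[] | left].
rewrite (_ : (A n <-> true) = A n) ?AP; last first.
  by apply/propext; split=> [[_ /(_ isT)]|].
by split=> h k; [case: (h k) => -[] | right].
Qed.

Lemma ce_token_lt : ce_relation token_lt.
Proof.
suff [c hc] : ce_set (fun z => token_lt (pr1 z) (pr2 z)).
  by exists c => x y; rewrite -hc !prE.
have cl (F : baire -> nat -> nat) :
    computable F -> computable (fun p x => level (F p x)).
  by move=> cF; rewrite /level; computable.
have ch (F : baire -> nat -> nat) :
    computable F -> computable (fun p x => height (F p x)).
  by move=> cF; rewrite /height; computable.
apply: ce_and.
  apply: ce_dec; apply: computable_andb.
    by apply: computable_eqn; computable.
  have cb (F : baire -> nat -> nat) :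
      computable F -> computable (fun p x => level (F p x) != 0).
    move=> cF; apply: computable_negb; apply: computable_eqn; first exact: cl.
    by computable.
  have ct : computable (fun _ z => height (pr1 z) < height (pr2 z)).
    by apply: computable_leq; [apply: computable_succ|]; apply: ch; computable.
  have c0 : computable (fun _ z => level (pr1 z) == 0).
    by apply: computable_eqn; [apply: cl|]; computable.
  have co := computable_orb (cb _ (computable_pr2 computable_id)) ct.
  have ca := computable_andb (cb _ (computable_pr2 computable_id)) ct.
  have := computable_if c0 co ca.
  congr computable; apply/funext => p; apply/funext => z.
  by rewrite /below; case: (level (pr1 z) == 0).
apply: (@ce_ball (fun z => height (pr2 z))
  (fun z k => evidence (level (pr2 z)) (pr1 (pr2 z)) k)).
  by apply: ch; computable.
have cz : computable (fun _ z => pr (pr1 (pr2 (pr1 z))) (pr2 z)) by computable.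
have c0 : computable (fun _ z => level (pr2 (pr1 z)) == 0).
  by apply: computable_eqn; [apply: cl|]; computable.
apply: ce_or; apply: ce_and.
- exact: ce_dec.
- by have := ce_comp ceQ cz; under [X in ce_set X]eq_fun do rewrite !prE.
- exact/ce_dec/computable_negb.
- by have := ce_comp ceP cz; under [X in ce_set X]eq_fun do rewrite !prE.
Qed.

Definition slice (n : nat) : set nat :=
  fun z => pr1 z = n /\ (level z != 0 -> A n).

(** A level that is correct for [n] has evidence up to any height, and tokens of [slice n] never
    exceed it in level. *)
Lemma token_lt_intro n l h x :
  (A n <-> l != 0) -> slice n x -> height x < h ->
  token_lt x (pr n (pr l h)).
Proof.
move=> Al [xn Ax] xh; split; last first.
  by move=> k _; rewrite /level !prE; exact: (evidenceP _ _).2.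
rewrite prE xn eqxx /= /below /level /height !prE; move: Ax Al xh.
rewrite /level /height; case: (pr1 (pr2 x) == 0) => /= Ax Al -> ; rewrite ?orbT //.
by rewrite andbT; apply/Al/Ax.
Qed.

Lemma slice_ideal n : is_ideal token_lt (slice n).
Proof.
split.
- by exists (pr n (pr 0 0)); split; rewrite /level !prE.
- move=> x y [/andP[/eqP xy bxy] ev] [yn Ay]; split; first by rewrite xy.
  move=> lx; apply: Ay; move: bxy; rewrite /below (negPf lx).
  by case/andP.
- move=> x y xn yn; pose l : nat := `[< A n >].
  have Al : A n <-> l != 0.
    by rewrite /l; split=> [An|]; [rewrite asboolT | case: asboolP].
  exists (pr n (pr l (maxn (height x) (height y)).+1)); split.
  + by split; rewrite /level !prE // => /Al.
  + by apply: token_lt_intro => //; rewrite ltnS leq_maxl.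
  + by apply: token_lt_intro => //; rewrite ltnS leq_maxr.
Qed.

(* Above a token of the top level, heights strictly increase; an ideal without
   such a token is a chain of increasing heights in level 0.  Either way the
   ideal collects all of the evidence for its level. *)
Lemma ideal_slice (I : set nat) a :
  is_ideal token_lt I -> I a -> I = slice (pr1 a).
Proof.
move=> [_ low dir] Ia; set n := pr1 a.
have In x : I x -> pr1 x = n.
  move=> Ix; have [z [_ xz az]] := dir _ _ Ix Ia.
  by case: xz az => /andP[/eqP-> _] _ [/andP[/eqP<- _] _].
have up x : I x -> exists2 z, I z & token_lt x z.
  by move=> Ix; have [z []] := dir x x Ix Ix; exists z.
(* [l] tells whether a token of nonzero level occurs in [I], and [t] realizes it. *)
have [l [t It lt] lI] : exists2 l : bool, exists2 t, I t & (level t != 0) = l &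
    forall z, I z -> level z != 0 -> l.
  have [[t It lt]|nI] := pselect (exists2 t, I t & level t != 0).
    by exists true => //; exists t.
  exists false => [|z Iz lz]; last by case: nI; exists z.
  by exists a => //; apply/negbTE/negP => la; apply: nI; exists a.
(* Nonzero level cannot drop, and [lI] forbids a rise from zero when [l] is false; the comparison
   must therefore raise the height. *)
have step x : I x -> (level x != 0) = l -> exists z,
    [/\ I z, token_lt x z, (level z != 0) = l & height x < height z].
  move=> Ix lx; have [z Iz xz] := up x Ix; exists z; have [/andP[_]] := xz.
  rewrite /below; have := lI z Iz; rewrite -lx.
  by case: (level x == 0) => /=; case: (level z == 0) => //= /(_ isT).
have climb N : exists z, [/\ I z, (level z != 0) = l, N <= height z &
    forall k, k < height z -> evidence (level z) n k].
  elim: N => [|N [z [Iz lz Nz _]]].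
    have [z [Iz [_ ev] lz _]] := step t It lt.
    by exists z; split=> // k /ev; rewrite In.
  have [w [Iw [_ ev] lw zw]] := step z Iz lz.
  exists w; split=> // [|k /ev]; last by rewrite In.
  exact: leq_ltn_trans zw.
have Al : A n <-> l.
  rewrite (_ : (l : Prop) = (l != 0 :> nat)); last by case: (l).
  apply/evidenceP => k; have [z [_ lz kz /(_ k kz)]] := climb k.+1.
  by rewrite /evidence eqb0 -lz !negbK.
apply/seteqP; split=> x.
  by move=> Ix; split; [exact: In | move/(lI x Ix)/Al].
(* Some token of [I] at level [l] lies higher than [x], so downward closure yields [x]. *)
move=> [xn Ax]; have [z [Iz lz xz ev]] := climb (height x).+1.
apply: (low _ z) => //; split; last by rewrite In.
rewrite xn (In z Iz) eqxx /below lz xz /=; case: eqP Ax => [_|_ /(_ isT)/Al ->] //.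
by rewrite orbT.
Qed.

End Tokens.

(** * From a Delta_2 set to an ideal presentation *)

Lemma quasi_Polish_of_Delta0_2 (A : set nat) :
  Delta0 2 A -> precomputably_quasi_Polish (S_space A).
Proof.
move=> [/(arithmetical_setC 2 A).1/Pi0_2E[Q ceQ AQ] /Pi0_2E[P ceP AP]].
exists (token_lt P Q); split; [exact: token_lt_trans | exact: ce_token_lt |].
pose R := token_lt P Q.
pose f (x : S_space A) : ideal_space R :=
  exist _ (slice A (sval x).1) (slice_ideal AP AQ _).
have /choice[g gE] (I : ideal_space R) : exists x : S_space A,
    sval I = slice A (sval x).1.
  case: I => I iI /=; have [[a Ia] _ _] := iI.
  have [x xa] := S_space_point A (pr1 a).
  by exists x; rewrite xa (ideal_slice AP AQ iI Ia).
have fE x : sval (f x) = slice A (sval x).1 by [].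
have slice_inj m n : slice A m = slice A n -> m = n.
  move=> mn; have : slice A m (pr m (pr 0 0)) by split; rewrite /level !prE.
  by rewrite mn => -[]; rewrite prE.
exists f, g; split.
- by move=> x; apply: S_space_eq; apply: slice_inj; rewrite -gE.
- move=> I; have := gE I; rewrite -fE; case: I (f _) => I iI [J iJ] /= IJ.
  exact: eq_exist.
(* The index [m] packs a proposed level, a position [i] and a height; the proposed level is used
   only if [p (2 * i + 1)] is nonzero, and level 0 otherwise. *)
- have [c hc] : computable (fun p m => pr (p 0) (pr
      (if p (2 * pr1 (pr2 m) + 1) is _.+1 then pr1 m else 0) (pr2 (pr2 m)))).
    by computable; apply: computable_odd; computable.
  exists c => p x /S_space_names[p0 Ap]; eexists; first by move=> m; exact: hc.
  change (slice A (sval x).1 = range (fun m => pr (p 0) (pr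
      (if p (2 * pr1 (pr2 m) + 1) is _.+1 then pr1 m else 0) (pr2 (pr2 m))))).
  apply/seteqP; split=> [z [zx Az]|_ [m _ <-]]; last first.
    split; rewrite /level !prE // => pm; apply/Ap.
    by exists (pr1 (pr2 m)); move: pm; case: (p _).
  have [z0|z0] := eqVneq (level z) 0.
    exists (pr 0 (pr 0 (height z))) => //; rewrite !prE p0 -zx.
    rewrite -[RHS]pr_eta -[in RHS](pr_eta (pr2 z)) -/(level z) z0.
    by case: (p _).
  have [i pi] := Ap.1 (Az z0).
  exists (pr (level z) (pr i (height z))) => //; rewrite !prE p0 -zx.
  by case: (p _) pi => // k _; rewrite !pr_eta.
(* Entry 0 gives the base of the tokens; entry [k > 0] is 1 iff one of the first [k] tokens has
   nonzero level. *)
- have [c hc] : computable (fun q k => if k is k'.+1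
      then iteri k (fun m y => if level (q m) is _.+1 then 1 else y) 0
      else pr1 (q 0)).
    by rewrite /level; computable.
  exists c => q I qI; eexists; first by move=> k; exact: hc.
  apply/S_space_names; split.
    have [] : slice A (sval (g I)).1 (q 0) by rewrite -gE qI; exists 0.
    by [].
  have qE n : iteri n (fun m y => if level (q m) is _.+1 then 1 else y) 0 != 0 <->
      exists2 m, m < n & level (q m) != 0.
    elim: n => [|n IHn] /=; first by split=> // -[].
    case e: (level (q n)) => [|k]; last by split=> // _; exists n; rewrite ?e.
    rewrite IHn; split=> -[m mn qm]; first by exists m => //; exact: ltnW.
    exists m => //; move: mn; rewrite ltnS leq_eqVlt => /orP[/eqP mn|//].
    by rewrite mn e in qm.
  have lE z : sval I z -> level z != 0 -> A (sval (g I)).1.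
    by rewrite gE => -[].
  split=> [Ag|[k]].
    have : sval I (pr (sval (g I)).1 (pr 1 0)).
      by rewrite gE; split; rewrite /level !prE.
    (* Position [2 * m + 1] inspects tokens up to index [2 * m], hence [q m]. *)
    rewrite qI => -[m _ qm]; exists m; rewrite addn1; apply/qE.
    by exists m; [rewrite ltnS mul2n -addnn leq_addr | rewrite qm /level !prE].
  by rewrite addn1 => /qE[m _ /lE]; apply; rewrite qI; exists m.
Qed.

Theorem proposition24 (A : set nat) :
  precomputably_quasi_Polish (S_space A) <-> Delta0 2 A.
Proof.
split=> [qpA|]; last exact: quasi_Polish_of_Delta0_2.
have := Pi0_2_of_quasi_Polish true qpA; have := Pi0_2_of_quasi_Polish false qpA.
rewrite (_ : (fun n => A n <-> false) = (~` A)%classic); last first.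
  by apply/funext => n; apply/propext; split=> [[h _] /h|nA] //; split.
rewrite (_ : (fun n => A n <-> true) = A); last first.
  by apply/funext => n; apply/propext; split=> [[_ /(_ isT)]|].
by move=> /(arithmetical_setC 2 _).2; rewrite setCK.
Qed.
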